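(* Let $u\in\{3,5,7,\dots\}$, $\lambda,\lambda'\in P_\ge^{u-3}$ and $[\gamma],[\gamma']\in\mathfrak h^*_{\mathbb R}/Q$. Assume that the product $\boxtimes$ induced by fusion on the Grothendieck group of weight $\mathsf A_2(u,2)$-modules is given by the standard Verlinde formula stated in the context. Then the Grothendieck fusion rules of the fully relaxed $\mathsf A_2(u,2)$-modules are $$\begin{aligned}\big[\widehat{\mathcal R}_{\lambda,[\gamma]}\big]\boxtimes\big[\widehat{\mathcal R}_{\lambda',[\gamma']}\big]=\sum_{\lambda''\in P_\ge^{u-3}}\mathbb N^{\mathsf{BP}\,\lambda''}_{\lambda,\lambda'}\Big(&2\big[\widehat{\mathcal R}_{\nabla^{-1}(\lambda''),[\gamma+\gamma']}\big]\\&+\big[\widehat\sigma^{-g^1}(\widehat{\mathcal R}_{\lambda'',[\gamma+\gamma'+u\omega_1/2]})\big]+\big[\widehat\sigma^{-g^2}(\widehat{\mathcal R}_{\nabla(\lambda''),[\gamma+\gamma'+u\omega_2/2]})\big]+\big[\widehat\sigma^{-g^3}(\widehat{\mathcal R}_{\nabla(\lambda''),[\gamma+\gamma'+u\omega_3/2]})\big]\\&+\big[\widehat\sigma^{g^1}(\widehat{\mathcal R}_{\nabla(\lambda''),[\gamma+\gamma'-u\omega_1/2]})\big]+\big[\widehat\sigma^{g^2}(\widehat{\mathcal R}_{\lambda'',[\gamma+\gamma'-u\omega_2/2]})\big]+\big[\widehat\sigma^{g^3}(\widehat{\mathcal R}_{\lambda'',[\gamma+\gamma'-u\omega_3/2]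})\big]\Big).\end{aligned}$$
   Context: Notation. $k=-3+\frac u2$. $\alpha_1,\alpha_2$ are the simple roots of $\mathfrak{sl}_3$, $\alpha_3=\alpha_1+\alpha_2$; $\omega_1,\omega_2$ the fundamental weights, $\omega_3=\omega_1-\omega_2$; $Q$ the root lattice, $\mathfrak h^*_{\mathbb R}$ the real span of the roots; $P^\vee\subset\mathfrak h$ is the coweight lattice with basis $g^1,g^2$, $\langle\alpha_i,g^j\rangle=\delta_{ij}$, and $g^3=g^1-g^2$; $\langle\cdot,\cdot\rangle$ is the form for which roots have norm squared $2$, on $\mathfrak h$, on $\mathfrak h^*$, and also the pairing between them; $S_3$ is the Weyl group. $P_\ge^{u-3}$ is the set of triples $\lambda=(\lambda_0,\lambda_1,\lambda_2)$ of nonnegative integers with sum $u-3$; in pairings $\lambda+\rho$ means $(\lambda_1+1)\omega_1+(\lambda_2+1)\omega_2$; $\varnothing=(u-3,0,0)$. $\nabla(\lambda_0,\lambda_1,\lambda_2)=(\lambda_1,\lambda_2,\lambda_0)$. $j_\lambda=-\frac{\lambda_1-\lambda_2}3$. S-matrices. $\mathsf S^{\mathsf{BP}}_{\lambda,\lambda'}=\frac{\mathrm i}{\sqrt3u}\mathrm e^{2\pi\mathrm i(j_\lambda+j_{\lambda'}-u/3)}\sum_{w\in S_3}\det(w)\mathrm e^{-4\pi\mathrm i\langle w(\lambda+\rho),\lambda'+\rho\rangle/u}$ and $\mathbb N^{\mathsf{BP}\,\nu}_{\lambda,\mu}=\sum_{\Lambda\in P_\ge^{u-3}}\frac{\mathsf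 S^{\mathsf{BP}}_{\lambda,\Lambda}\mathsf S^{\mathsf{BP}}_{\mu,\Lambda}(\mathsf S^{\mathsf{BP}}_{\nu,\Lambda})^*}{\mathsf S^{\mathsf{BP}}_{\varnothing,\Lambda}}$ (the Bershadsky–Polyakov fusion coefficients). $\widehat{\mathsf S}_{(g,\lambda,\gamma),(g',\lambda',\gamma')}=\mathrm e^{-2\pi\mathrm i(\langle g,g'\rangle u/2+\langle\gamma,g'\rangle+\langle g,\gamma'\rangle)}\mathsf S^{\mathsf{BP}}_{\lambda,\lambda'}$. $\widehat{\mathsf S}^{\mathrm{hw}}_{(\varnothing),(g',\lambda',\gamma')}=\dfrac{\mathrm e^{-2\pi\mathrm i(j_{\lambda'}-u/3)}\,\mathsf S^{\mathsf{BP}}_{\varnothing,\lambda'}}{2\left(1+\cos(2\pi(\langle g^1,\gamma'\rangle-j_{\lambda'}+\frac u3))+\cos(2\pi(\langle g^2,\gamma'\rangle+j_{\lambda'}-\frac u3))+\cos(2\pi(\langle g^3,\gamma'\rangle+j_{\lambda'}-\frac u3))\right)}$. Standard Verlinde formula. $[M]$ denotes the image of $M$ in the (suitably completed) Grothendieck group of finitely generated weight $\mathsf A_2(u,2)$-modules with finite multiplicities, and $$[\widehat\sigma^g(\widehat{\mathcal R}_{\lambda,[\gamma]})]\boxtimes[\widehat\sigma^{g'}(\widehat{\mathcal R}_{\lambda',[\gamma']})]=\sum_{g''\in P^\vee}\sum_{\lambda''\in P_\ge^{u-3}}\int_{\mathfrak h^*_{\mathbb R}/Q}\widehat{\mathbb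 N}_{(g,\lambda,\gamma),(g',\lambda',\gamma')}^{(g'',\lambda'',\gamma'')}[\widehat\sigma^{g''}(\widehat{\mathcal R}_{\lambda'',[\gamma'']})]\,\mathrm d[\gamma''],$$ $$\widehat{\mathbb N}_{(g,\lambda,\gamma),(g',\lambda',\gamma')}^{(g'',\lambda'',\gamma'')}=\sum_{G\in P^\vee}\sum_{\Lambda\in P_\ge^{u-3}}\int_{\mathfrak h^*_{\mathbb R}/Q}\frac{\widehat{\mathsf S}_{(g,\lambda,\gamma),(G,\Lambda,\Gamma)}\,\widehat{\mathsf S}_{(g',\lambda',\gamma'),(G,\Lambda,\Gamma)}\,\widehat{\mathsf S}^*_{(g'',\lambda'',\gamma''),(G,\Lambda,\Gamma)}}{\widehat{\mathsf S}^{\mathrm{hw}}_{(\varnothing),(G,\Lambda,\Gamma)}}\,\mathrm d[\Gamma],$$ where integrals are with respect to the translation-invariant measure of total mass $1$, $*$ is complex conjugation, and sums over $P^\vee$ of phases are interpreted as delta functions. Modules. $\mathsf A_2(u,2)$ is the simple affine vertex operator algebra of $\mathfrak{sl}_3$ at level $k$. $\widehat{\mathcal R}_{\lambda,[\gamma]}$, with $\gamma=(j_\lambda+\mu+\frac u6)\alpha_2+(\nu-\frac u6)\alpha_3$, is the restriction of $\mathcal H_\lambda\otimes\mathcal W_{[\mu]}\otimes\Pi_{[\nu]}$ along the inverse-reduction embedding $\mathsf A_2(u,2)\hookrightarrow\mathsf{BP}(u,2)\otimes\mathsf G\otimes\Pi$. Here: $\mathsf{BP}(u,2)$ is the simple quotient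 of the Bershadsky–Polyakov algebra of level $k$ (the minimal quantum hamiltonian reduction of the universal affine vertex algebra of $\mathfrak{sl}_3$), strongly generated by $J,L,G^+,G^-$ with $L$ a conformal vector giving $J,G^+,G^-$ conformal weights $1,2,1$, $J(z)J(w)\sim\frac{2k+3}{3(z-w)^2}$, $J(z)G^\pm(w)\sim\frac{\pm G^\pm(w)}{z-w}$, $G^\pm(z)G^\pm(w)\sim0$, $G^+(z)G^-(w)\sim\frac{(k+1)(2k+3)}{(z-w)^3}+\frac{3(k+1)J(w)}{(z-w)^2}+\frac{3:JJ:(w)+k\partial J(w)-(k+3)L(w)}{z-w}$; $\mathcal H_\lambda$ is its irreducible highest-weight module of $J_0$-eigenvalue $j_\lambda$ and $L_0$-eigenvalue $\frac{(\lambda_1-\lambda_2)(\lambda_1-\lambda_2-u)+3(\lambda_1+\lambda_2)(\lambda_1+\lambda_2-u+4)}{6u}$ (highest-weight vectors are killed by positive modes and $G^+_0$); $\mathsf G$ is the bosonic ghost algebra $\beta(z)\gamma(w)\sim\frac{-1}{z-w}$ with relaxed Verma modules $\mathcal W_{[\mu]}$ (top space with ${:}\beta\gamma{:}_0$-eigenvalues $[\mu]$, each of multiplicity $1$; $\mathcal W_{[0]}$ the direct sum of the vacuum module and its conjugate); $\Pi$ is generated by Heisenberg fields $a,d$ with $a(z)a(w)\sim0\sim d(z)d(w)$, $a(z)d(w)\sim\frac2{(z-w)^2}$ and $\mathrm e^{ma}$, $m\in\mathbb Z$, with module $\Pi_{[\nu]}$ generated by $\mathrm e^{\nu a-d/2}$;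 the embedding has $e^1\mapsto\gamma\mathrm e^a$, $e^2\mapsto\beta$, $e^3\mapsto\mathrm e^a$, $h^1\mapsto-J-{:}\beta\gamma{:}+i^1$, $h^2\mapsto2J+2{:}\beta\gamma{:}+i^2$, $f^1\mapsto G^+\mathrm e^{-a}-J\beta\mathrm e^{-a}+\beta{:}i^2\mathrm e^{-a}{:}+(k+1)\partial\beta\mathrm e^{-a}$, $f^2\mapsto G^--2J\gamma-\gamma i^2-{:}\gamma\gamma\beta{:}-k\partial\gamma$ with $i^1=\frac{2k}3a+\frac12d$, $i^2=-\frac k3a+\frac12d$ and $e^1,e^2,e^3,f^1,f^2=E_{12},E_{23},E_{13},E_{21},E_{32}$. $\widehat\sigma^g$ is the spectral flow functor: twisting by the automorphism $e^i_n\mapsto e^i_{n-\langle\alpha_i,g\rangle}$, $f^i_n\mapsto f^i_{n+\langle\alpha_i,g\rangle}$, $h_n\mapsto h_n-\langle g,h\rangle\delta_{n,0}K$ of $\widehat{\mathfrak{sl}}_3$. *)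

(* Defs.v *)
From HB Require Import structures.
From mathcomp Require Import all_boot all_order all_fingroup all_algebra.
From mathcomp Require Import complex ring_quotient.
From mathcomp Require Import all_classical all_reals all_analysis.

Set Implicit Arguments.
Unset Strict Implicit.
Unset Printing Implicit Defensive.

Import Order.TTheory GRing.Theory Num.Theory.
Local Open Scope ring_scope.
Local Open Scope quotient_scope.

Section LinearAlgebra.
Variable K : fieldType.

Definition is_subspace (M : lmodType K) (U : M -> Prop) : Prop :=
  U 0 /\ forall (c : K) x y, U x -> U y -> U (c *: x + y).

Definition in_span (M : lmodType K) (S : M -> Prop) (x : M) : Prop :=
  forall U, is_subspace U -> (forall s, S s -> U s) -> U x.

Definition fin_dim (M : lmodType K) (U : M -> Prop) : Prop :=
  exists s : seq M, forall x, U x -> in_span (fun y => y \in s) x.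

Definition trilinear (H W P M : lmodType K) (t : H -> W -> P -> M) : Prop :=
  [/\ forall w p, linear (fun h => t h w p),
      forall h p, linear (fun w => t h w p)
    & forall h w, linear (fun p => t h w p)].

(* [M] is the tensor product of [H], [W] and [P], and [t h w p] is the pure
   tensor of [h], [w], [p]. *)
Definition is_tensor3 (H W P M : lmodType K) (t : H -> W -> P -> M) : Prop :=
  trilinear t /\
  forall (Z : lmodType K) (s : H -> W -> P -> Z), trilinear s ->
    exists f : M -> Z,
      [/\ linear f, forall h w p, f (t h w p) = s h w p
        & forall f' : M -> Z, linear f' ->
            (forall h w p, f' (t h w p) = s h w p) -> f' =1 f].

End LinearAlgebra.

Section VertexAlgebras.
Variable K : fieldType.

(* The binomial coefficient "p choose j" for an integer p. *)
Definition binz (p : int) (j : nat) : K :=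
  (\prod_(i < j) (p%:~R - i%:R)) / (j`!)%:R.

(* Coefficients of the Jacobi identity.  [act n a] is the mode a_(n), where
   a(z) = \sum_n a_(n) z^(-n-1), and the infinite sums over j are finite sums:
   they may be cut off at any N beyond which all the terms vanish. *)
Definition borcherds_identity (V M : lmodType K)
    (prod : int -> V -> V -> V) (act : int -> V -> M -> M) : Prop :=
  forall (a b : V) (c : M) (p q r : int) (N : nat),
    (forall j : nat, (N <= j)%N ->
       [/\ prod (r + j%:Z) a b = 0, act (q + j%:Z) b c = 0
         & act (p + j%:Z) a c = 0]) ->
    \sum_(j < N) binz p j *: act (p + q - j%:Z) (prod (r + j%:Z) a b) c =
    \sum_(j < N) ((-1) ^+ j * binz r j) *:
      (act (p + r - j%:Z) a (act (q + j%:Z) b c)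
       - (-1) ^ r *: act (q + r - j%:Z) b (act (p + j%:Z) a c)).

Record vertexAlgebra := VertexAlgebra {
  va_sort :> lmodType K;
  vac : va_sort;
  va_prod : int -> va_sort -> va_sort -> va_sort;
  va_linearl : forall n b, linear (fun a => va_prod n a b);
  va_linearr : forall n a, linear (va_prod n a);
  va_trunc : forall a b, exists N : nat,
    forall j : nat, (N <= j)%N -> va_prod j%:Z a b = 0;
  va_vacl : forall n a, va_prod n vac a = if n == -1 then a else 0;
  va_vacr : forall a, va_prod (-1) a vac = a;
  va_vacr0 : forall a (n : nat), va_prod n%:Z a vac = 0;
  va_borcherds : borcherds_identity va_prod va_prod
}.

Record vaModule (V : vertexAlgebra) := VaModule {
  vm_sort :> lmodType K;
  vm_act : int -> V -> vm_sort -> vm_sort;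
  vm_linearl : forall n m, linear (fun a => vm_act n a m);
  vm_linearr : forall n a, linear (vm_act n a);
  vm_trunc : forall a m, exists N : nat,
    forall j : nat, (N <= j)%N -> vm_act j%:Z a m = 0;
  vm_vac : forall n m, vm_act n (vac V) m = if n == -1 then m else 0;
  vm_borcherds : borcherds_identity (@va_prod V) vm_act
}.

Section Algebra.
Variable V : vertexAlgebra.

(* The states of the fields :ab:(z) and da(z)/dz. *)
Definition nop (a b : V) : V := va_prod (-1) a b.
Definition der (a : V) : V := va_prod (-2) a (vac V).

(* [ope a b [:: c0; c1; ...]] is
   a(z)b(w) ~ c0(w)/(z-w) + c1(w)/(z-w)^2 + ... *)
Definition ope (a b : V) (s : seq V) : Prop :=
  forall n : nat, va_prod n%:Z a b = nth 0 s n.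

Definition strongly_generated (S : V -> Prop) : Prop :=
  forall U : V -> Prop, is_subspace U -> U (vac V) ->
    (forall x (n : nat) v, S x -> U v -> U (va_prod (- n.+1%:Z) x v)) ->
    forall v, U v.

Definition is_ideal (U : V -> Prop) : Prop :=
  [/\ is_subspace U, forall n a v, U v -> U (va_prod n a v)
    & forall v, U v -> U (der v)].

Definition simple_va : Prop :=
  vac V <> 0 /\
  forall U, is_ideal U -> (forall v, U v -> v = 0) \/ (forall v, U v).

Definition is_conformal (L : V) : Prop :=
  (exists c : K,
     ope L L [:: der L; 2%:R *: L; 0; (c / 2%:R) *: vac V]) /\
  (forall v, va_prod 0 L v = der v).

End Algebra.

Record is_va_hom (V V' : vertexAlgebra) (f : V -> V') : Prop := IsVaHom {
  vah_linear : linear f;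
  vah_vac : f (vac V) = vac V';
  vah_prod : forall n a b, f (va_prod n a b) = va_prod n (f a) (f b)
}.

(* [X] is the tensor product of the vertex algebras [B], [G] and [P], with the
   given inclusions of the three factors. *)
Record is_va_tensor3 (B G P X : vertexAlgebra)
    (iB : B -> X) (iG : G -> X) (iP : P -> X) : Prop := IsVaTensor3 {
  vat_homB : is_va_hom iB;
  vat_homG : is_va_hom iG;
  vat_homP : is_va_hom iP;
  vat_commBG : forall m n b g x,
    va_prod m (iB b) (va_prod n (iG g) x) =
    va_prod n (iG g) (va_prod m (iB b) x);
  vat_commBP : forall m n b p x,
    va_prod m (iB b) (va_prod n (iP p) x) =
    va_prod n (iP p) (va_prod m (iB b) x);
  vat_commGP : forall m n g p x,
    va_prod m (iG g) (va_prod n (iP p) x) =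
    va_prod n (iP p) (va_prod m (iG g) x);
  vat_tensor : is_tensor3 (fun b g p => nop (iB b) (nop (iG g) (iP p)))
}.

Section Modules.
Variable V : vertexAlgebra.
Implicit Types M N : vaModule V.

Definition is_submodule M (U : M -> Prop) : Prop :=
  is_subspace U /\ forall n a m, U m -> U (vm_act n a m).

Definition gen_submodule M (S : M -> Prop) (x : M) : Prop :=
  forall U, is_submodule U -> (forall s, S s -> U s) -> U x.

Definition generated_by M (S : M -> Prop) : Prop :=
  forall x, gen_submodule S x.

Definition simple_module M : Prop :=
  (exists m : M, m <> 0) /\
  forall U : M -> Prop, is_submodule U ->
    (forall m, U m -> m = 0) \/ (forall m, U m).

Definition is_module_hom M N (f : M -> N) : Prop :=
  linear f /\ forall n a m, f (vm_act n a m) = vm_act n a (f m).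

Definition module_iso M N : Prop :=
  exists f : M -> N, is_module_hom f /\ bijective f.

Definition short_exact M1 M2 M3 (f : M1 -> M2) (g : M2 -> M3) : Prop :=
  [/\ is_module_hom f, is_module_hom g, injective f,
      (forall z, exists y, g y = z)
    & (forall y, g y = 0 <-> exists x, y = f x)].

End Modules.

Section Restriction.
Variables (V V' : vertexAlgebra) (f : V -> V') (hf : is_va_hom f).
Variable M : vaModule V'.

Let act n a (m : M) := vm_act n (f a) m.

Lemma restrict_linearl n m : linear (fun a => act n a m).
Proof. by move=> c x y; rewrite /act (vah_linear hf) vm_linearl. Qed.

Lemma restrict_linearr n a : linear (act n a).
Proof. exact: vm_linearr. Qed.

Lemma restrict_trunc a m : exists N : nat,
  forall j : nat, (N <= j)%N -> act j%:Z a m = 0.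
Proof. exact: vm_trunc. Qed.

Lemma restrict_vac n m : act n (vac V) m = if n == -1 then m else 0.
Proof. by rewrite /act (vah_vac hf) vm_vac. Qed.

Lemma restrict_borcherds : borcherds_identity (@va_prod V) act.
Proof.
move=> a b c p q r N h; have f0 : f 0 = 0.
  by have := vah_linear hf (-1) 0 0; rewrite scaler0 addr0 scaleN1r addNr.
rewrite /act; under eq_bigr => j _ do rewrite (vah_prod hf).
apply: vm_borcherds => j Nj; case: (h j Nj) => h1 h2 h3.
by split=> //; rewrite -(vah_prod hf) h1 f0.
Qed.

Definition restrict : vaModule V :=
  VaModule restrict_linearl restrict_linearr restrict_trunc restrict_vac
    restrict_borcherds.

End Restriction.

(* Logarithmic intertwining operators of type (F ; M N):
   Y(m, z) n = \sum_(r in K, j) (y r j m n) z^(-r-1) (log z)^j.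
   [L] is the conformal vector of [V]; its mode L_(0) is L_{-1}. *)
Record is_intertwiner (V : vertexAlgebra) (L : V) (M N F : vaModule V)
    (y : K -> nat -> M -> N -> F) : Prop := IsIntertwiner {
  io_linearl : forall r j n, linear (fun m => y r j m n);
  io_linearr : forall r j m, linear (y r j m);
  io_trunc : forall m n r, exists B : nat,
    forall (i j : nat), (B <= i)%N -> y (r + i%:R) j m n = 0;
  io_log : forall m n r, exists B : nat,
    forall j : nat, (B <= j)%N -> y r j m n = 0;
  io_der : forall r j m n,
    y r j (vm_act 0 L m) n =
    - r *: y (r - 1) j m n + j.+1%:R *: y (r - 1) j.+1 m n;
  io_jacobi : forall (a : V) (m : M) (n : N) (p r : int) (q : K) (l B : nat),
    (forall j : nat, (B <= j)%N ->
       [/\ vm_act (r + j%:Z) a m = 0, y (q + j%:R) l m n = 0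
         & vm_act (p + j%:Z) a n = 0]) ->
    \sum_(j < B) binz p j *:
       y (p%:~R + q - j%:R) l (vm_act (r + j%:Z) a m) n =
    \sum_(j < B) ((-1) ^+ j * binz r j) *:
      (vm_act (p + r - j%:Z) a (y (q + j%:R) l m n)
       - (-1) ^ r *: y (q + r%:~R - j%:R) l m (vm_act (p + j%:Z) a n))
}.

(* [F] is the fusion product of [M] and [N] in the category [cat]: it is the
   target of a universal intertwining operator. *)
Definition is_fusion_product (V : vertexAlgebra) (L : V)
    (cat : vaModule V -> Prop) (M N F : vaModule V) : Prop :=
  cat F /\
  exists y : K -> nat -> M -> N -> F, is_intertwiner L y /\
  forall (F' : vaModule V) (y' : K -> nat -> M -> N -> F'),
    cat F' -> is_intertwiner L y' ->
    exists f : F -> F',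
      [/\ is_module_hom f, forall r j m n, f (y r j m n) = y' r j m n
        & forall f' : F -> F', is_module_hom f' ->
            (forall r j m n, f' (y r j m n) = y' r j m n) -> f' =1 f].

End VertexAlgebras.

(* h^*_R in the basis of simple roots, so that the root lattice Q consists of
   the vectors with integer coordinates. *)
Notation hR R := 'rV[R]_2.

Section Lattices.
Variable R : realType.

Definition wt (a b : R) : hR R := \row_(i < 2) (if i == 0 then a else b).

Definition alpha1 : hR R := wt 1 0.
Definition alpha2 : hR R := wt 0 1.
Definition alpha3 : hR R := alpha1 + alpha2.
Definition omega1 : hR R := wt (2 / 3) (1 / 3).
Definition omega2 : hR R := wt (1 / 3) (2 / 3).
Definition omega3 : hR R := omega1 - omega2.

(* The standard realisation of the root system of sl_3 in the hyperplane of
   R^3 of vectors with coordinate sum 0: alpha_1 = (1, -1, 0) and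
   alpha_2 = (0, 1, -1), with the dot product, and S_3 permuting coordinates. *)
Definition eps (x : hR R) : 'rV[R]_3 :=
  \row_(i < 3) (if i == 0 then x 0 0 else if i == 1 then x 0 1 - x 0 0
                else - x 0 1).
Definition dot3 (x y : 'rV[R]_3) : R := \sum_(i < 3) x 0 i * y 0 i.
Definition form (x y : hR R) : R := dot3 (eps x) (eps y).
Definition weyl_form (w : 'S_3) (x y : hR R) : R :=
  dot3 (col_perm w (eps x)) (eps y).

Definition root_lattice : {pred hR R} :=
  [pred x : hR R | [forall i, x 0 i \is a Num.int]].

Lemma root_lattice_closed : zmod_closed root_lattice.
Proof.
split=> [|x y /forallP hx /forallP hy]; apply/forallP => i.
  by rewrite mxE rpred0.
by rewrite !mxE rpredB ?hx ?hy.
Qed.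

HB.instance Definition _ :=
  GRing.isZmodClosed.Build (hR R) root_lattice root_lattice_closed.

Definition torus : Type := Quotient.quot root_lattice.
HB.instance Definition _ := GRing.Zmodule.on torus.
Definition cls (x : hR R) : torus := \pi_torus x.

End Lattices.

(* The coweight lattice, in the basis g^1, g^2 dual to the simple roots. *)
Notation coweight := 'rV[int]_2.

Definition cowt (a b : int) : coweight := \row_(i < 2) (if i == 0 then a else b).
Definition g1 : coweight := cowt 1 0.
Definition g2 : coweight := cowt 0 1.
Definition g3 : coweight := g1 - g2.

(* As a diagonal matrix modulo scalars, a coweight g is diag(cow_diag g i);
   in particular <eps_i - eps_j, g> = cow_diag g i - cow_diag g j. *)
Definition cow_diag (g : coweight) (i : 'I_3) : int :=
  \sum_(l < 2 | (i <= l)%N) g 0 l.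

Section Pairings.
Variable R : realType.

Definition pair (x : hR R) (g : coweight) : R :=
  \sum_(i < 2) x 0 i * (g 0 i)%:~R.
(* The form identifies g^j with omega_j. *)
Definition cow_wt (g : coweight) : hR R :=
  (g 0 0)%:~R *: omega1 R + (g 0 1)%:~R *: omega2 R.
Definition cow_form (g g' : coweight) : R := form (cow_wt g) (cow_wt g').

End Pairings.

Definition labels : Type := (nat * nat * nat)%type.

(* The entries are bounded by u only to make this a finite type. *)
Definition alcove (u : nat) : Type :=
  {l : 'I_u * 'I_u * 'I_u | (l.1.1 + l.1.2 + l.2 == u - 3)%N}.
HB.instance Definition _ (u : nat) := Finite.on (alcove u).

Definition to_labels (u : nat) (l : alcove u) : labels :=
  (val (val l).1.1, val (val l).1.2, val (val l).2).

Lemma nabla_subproof (u : nat) (l : alcove u) :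
  ((val l).1.2 + (val l).2 + (val l).1.1 == u - 3)%N.
Proof. by rewrite addnC addnA (valP l). Qed.

Lemma nablaV_subproof (u : nat) (l : alcove u) :
  ((val l).2 + (val l).1.1 + (val l).1.2 == u - 3)%N.
Proof. by rewrite -addnA addnC (valP l). Qed.

Definition nabla (u : nat) (l : alcove u) : alcove u :=
  exist _ ((val l).1.2, (val l).2, (val l).1.1) (nabla_subproof l).
Definition nablaV (u : nat) (l : alcove u) : alcove u :=
  exist _ ((val l).2, (val l).1.1, (val l).1.2) (nablaV_subproof l).

Lemma nablaK (u : nat) : cancel (@nabla u) (@nablaV u).
Proof. by move=> [[[a b] c] h]; apply: val_inj. Qed.

Lemma nablaVK (u : nat) : cancel (@nablaV u) (@nabla u).
Proof. by move=> [[[a b] c] h]; apply: val_inj. Qed.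

Section Verlinde.
Variables (R : realType) (u : nat).
Local Notation C := R[i].

Definition phase (x : R) : C := Complex (cos (2 * pi * x)) (sin (2 * pi * x)).

Definition jwt (l : labels) : R := - (l.1.2%:R - l.2%:R) / 3.
Definition rho_shift (l : labels) : hR R :=
  l.1.2.+1%:R *: omega1 R + l.2.+1%:R *: omega2 R.
Definition vac_labels : labels := ((u - 3)%N, 0%N, 0%N).

Definition S_BP (l l' : labels) : C :=
  'i / (real_complex R (Num.sqrt 3 * u%:R)) *
  phase (jwt l + jwt l' - u%:R / 3) *
  \sum_(w : 'S_3) (-1) ^+ w *
     phase (- 2 * weyl_form w (rho_shift l) (rho_shift l') / u%:R).

Definition N_BP (l m n : labels) : C :=
  \sum_(L : alcove u)
    S_BP l (to_labels L) * S_BP m (to_labels L) * (S_BP n (to_labels L))^*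
    / S_BP vac_labels (to_labels L).

Definition S_hat (g : coweight) (l : labels) (x : hR R)
    (g' : coweight) (l' : labels) (x' : hR R) : C :=
  phase (- (cow_form R g g' * u%:R / 2 + pair x g' + pair x' g)) * S_BP l l'.

(* This entry does not depend on g'. *)
Definition S_hw (g' : coweight) (l' : labels) (x' : hR R) : C :=
  phase (- (jwt l' - u%:R / 3)) * S_BP vac_labels l' /
  real_complex R (2 *
    (1 + cos (2 * pi * (pair x' g1 - jwt l' + u%:R / 3))
       + cos (2 * pi * (pair x' g2 + jwt l' - u%:R / 3))
       + cos (2 * pi * (pair x' g3 + jwt l' - u%:R / 3)))).

(* Integral of a Q-periodic function on h^*_R over h^*_R / Q, for the invariant
   measure of total mass 1: the fundamental domain is [0, 1]^2 in the basis of
   simple roots. *)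
Definition unit_int (f : R -> R) : R :=
  (\int[@lebesgue_measure R]_(x in `[0%R, 1%R]%classic) f x)%R.
Definition torus_int (F : hR R -> C) : C :=
  Complex
    (unit_int (fun a => unit_int (fun b => complex.Re (F (wt a b)))))
    (unit_int (fun a => unit_int (fun b => complex.Im (F (wt a b))))).

Definition verlinde_term (g : coweight) (l : labels) (x : hR R)
    (g' : coweight) (l' : labels) (x' : hR R)
    (g'' : coweight) (l'' : labels) (x'' : hR R) (G : coweight) : C :=
  \sum_(L : alcove u) torus_int (fun X =>
    S_hat g l x G (to_labels L) X * S_hat g' l' x' G (to_labels L) X *
    (S_hat g'' l'' x'' G (to_labels L) X)^* / S_hw G (to_labels L) X).

(* Sums over the coweight lattice of phases are delta functions:
   \sum_G exp(2 pi i <x - p, G>) = delta([x] - [p]) on h^*_R / Q.  Accordingly,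
   a series \sum_G phi_G of functions of x is the finite combination
   \sum_((c, p) in s) c delta([x] - [p]) when each phi_G(x) is
   \sum_((c, p) in s) c exp(2 pi i <x - p, G>). *)
Definition is_delta_comb (phi : coweight -> hR R -> C) (s : seq (C * hR R)) :
    Prop :=
  forall G x, phi G x = \sum_(d <- s) d.1 * phase (pair (x - d.2) G).

(* Integral of an E-valued function on h^*_R / Q against such a combination. *)
Definition delta_int (E : lmodType C) (s : seq (C * hR R))
    (F : torus R -> E) : E :=
  \sum_(d <- s) d.1 *: F (cls d.2).

(* The standard Verlinde formula for a product [box] on [E], where
   [st g l t] stands for the class of the standard module of index (g, l, t).
   [D g'' l''] is the Verlinde coefficient as a distribution in [x''] and
   [I] contains the finitely many g'' for which it is nonzero. *)
Definition standard_verlinde (E : lmodType C) (box : E -> E -> E)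
    (st : coweight -> alcove u -> torus R -> E) : Prop :=
  forall (g g' : coweight) (l l' : alcove u) (x x' : hR R),
  exists (I : seq coweight) (D : coweight -> alcove u -> seq (C * hR R)),
    [/\ uniq I,
        forall g'' l'', is_delta_comb
          (fun G x'' => verlinde_term g (to_labels l) x g' (to_labels l') x'
                          g'' (to_labels l'') x'' G) (D g'' l''),
        forall g'' l'', g'' \notin I -> D g'' l'' = [::]
      & box (st g l (cls x)) (st g' l' (cls x')) =
        \sum_(g'' <- I) \sum_(l'' : alcove u)
          delta_int (D g'' l'') (st g'' l'')].

End Verlinde.

Section InverseReduction.
Variable R : realType.
Local Notation C := R[i].
Local Notation "a ** b" := (nop a b) (at level 40, left associativity).

Definition E3 (i j : 'I_3) : 'M[C]_3 := delta_mx i j.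

(* sl_3 is the space of traceless matrices: only the values of [x] there matter.
   These axioms determine [A] up to isomorphism (for k <> -3), since every ideal
   of the universal affine vertex algebra is graded. *)
Record is_simple_affine_sl3 (k : C) (A : vertexAlgebra C) (x : 'M[C]_3 -> A) :
    Prop := IsSimpleAffine {
  aff_linear : forall (c : C) (a b : 'M[C]_3),
    \tr a = 0 -> \tr b = 0 -> x (c *: a + b) = c *: x a + x b;
  aff_ope : forall a b : 'M[C]_3, \tr a = 0 -> \tr b = 0 ->
    ope (x a) (x b)
      [:: x (a *m b - b *m a); (k * \tr (a *m b)) *: vac A];
  aff_gen : strongly_generated (fun v => exists2 a, \tr a = 0 & v = x a);
  aff_simple : simple_va A
}.

(* The Sugawara vector, for k <> -3: half the Casimir state over k + 3. *)
Definition sugawara (k : C) (A : vertexAlgebra C) (x : 'M[C]_3 -> A) : A :=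
  (2 * (k + 3))^-1 *:
  (\sum_(i < 3) \sum_(j < 3 | i != j) x (E3 i j) ** x (E3 j i)
   + 3^-1 *: \sum_(i < 3) \sum_(j < 3 | (i < j)%N)
       x (E3 i i - E3 j j) ** x (E3 i i - E3 j j)).

Record is_simple_BP (k : C) (B : vertexAlgebra C) (J L Gp Gm : B) : Prop :=
  IsSimpleBP {
  bp_conformal : is_conformal L;
  bp_wtJ : va_prod 1 L J = J;
  bp_wtGp : va_prod 1 L Gp = 2 *: Gp;
  bp_wtGm : va_prod 1 L Gm = Gm;
  bp_JJ : ope J J [:: 0; ((2 * k + 3) / 3) *: vac B];
  bp_JGp : ope J Gp [:: Gp];
  bp_JGm : ope J Gm [:: - Gm];
  bp_GpGp : ope Gp Gp [::];
  bp_GmGm : ope Gm Gm [::];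
  bp_GpGm : ope Gp Gm
    [:: 3 *: (J ** J) + k *: der J - (k + 3) *: L;
        (3 * (k + 1)) *: J;
        ((k + 1) * (2 * k + 3)) *: vac B];
  bp_gen : strongly_generated (fun v => [\/ v = J, v = L, v = Gp | v = Gm]);
  bp_simple : simple_va B
}.

Record is_ghosts (G : vertexAlgebra C) (be ga : G) : Prop := IsGhosts {
  gh_nontrivial : vac G <> 0;
  gh_bg : ope be ga [:: - vac G];
  gh_bb : ope be be [::];
  gh_gg : ope ga ga [::];
  gh_gen : strongly_generated (fun v => v = be \/ v = ga)
}.

(* The half-lattice vertex algebra; [ex m] is e^(ma). *)
Record is_half_lattice (P : vertexAlgebra C) (a d : P) (ex : int -> P) : Prop :=
  IsHalfLattice {
  hl_nontrivial : vac P <> 0;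
  hl_aa : ope a a [::];
  hl_dd : ope d d [::];
  hl_ad : ope a d [:: 0; 2 *: vac P];
  hl_ae : forall m, ope a (ex m) [::];
  hl_de : forall m, ope d (ex m) [:: (2 * m%:~R) *: ex m];
  hl_ee : forall m n, ope (ex m) (ex n) [::];
  hl_e0 : ex 0 = vac P;
  hl_eD : forall m n, ex m ** ex n = ex (m + n);
  hl_der : forall m, der (ex m) = m%:~R *: (a ** ex m);
  hl_gen : strongly_generated
    (fun v => [\/ v = a, v = d | exists m, v = ex m])
}.

(* The modes of a field x of conformal weight h are x_n = x_(n+h-1), and J, L,
   G^+, G^- have conformal weights 1, 2, 2, 1.  A highest-weight vector is
   killed by G^+_0 = G^+_(1) and by the modes x_n with n > 0. *)
Definition is_hw_BP (u : nat) (l : labels) (B : vertexAlgebra C)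
    (J L Gp Gm : B) (H : vaModule B) : Prop :=
  simple_module H /\
  exists v : H,
    [/\ v <> 0,
        forall n : nat,
          [/\ vm_act n.+1%:Z J v = 0, vm_act n.+2%:Z L v = 0,
              vm_act n.+1%:Z Gp v = 0 & vm_act n.+1%:Z Gm v = 0],
        vm_act 0 J v = real_complex R (jwt R l) *: v
      & let l1 : R := l.1.2%:R in let l2 : R := l.2%:R in
        vm_act 1 L v = real_complex R
          (((l1 - l2) * (l1 - l2 - u%:R)
            + 3 * (l1 + l2) * (l1 + l2 - u%:R + 4)) / (6 * u%:R)) *: v].

(* Here beta and gamma have weights 1 and 0: beta_n = beta_(n) and
   gamma_n = gamma_(n-1). *)
Definition is_relaxed_ghost (mu : R) (G : vertexAlgebra C) (be ga : G)
    (W : vaModule G) : Prop :=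
  let top (w : W) := forall n : nat,
    vm_act n.+1%:Z be w = 0 /\ vm_act n%:Z ga w = 0 in
  if mu \is a Num.int then
    (* The vacuum module, generated by [v0], and its conjugate, by [v1]. *)
    exists v0 v1 : W,
      let U0 := gen_submodule (fun w => w = v0) in
      let U1 := gen_submodule (fun w => w = v1) in
      [/\ v0 <> 0 /\ v1 <> 0,
          top v0 /\ vm_act 0 be v0 = 0,
          top v1 /\ vm_act (-1) ga v1 = 0,
          forall w, exists w0 w1, [/\ U0 w0, U1 w1 & w = w0 + w1]
        & forall w, U0 w -> U1 w -> w = 0]
  else
    exists v : int -> W,
      [/\ forall n, v n <> 0 /\ top (v n),
          forall n, vm_act 0 (be ** ga) (v n) =
                    real_complex R (mu + n%:~R) *: v n,
          forall w, top w -> in_span (fun x => exists n, x = v n) w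
        & generated_by (fun x => exists n, x = v n)].

(* The generator is e^(nu a - d/2). *)
Definition is_half_lattice_module (nu : R) (P : vertexAlgebra C) (a d : P)
    (N : vaModule P) : Prop :=
  exists v : N,
    [/\ v <> 0,
        forall n : nat, vm_act n.+1%:Z a v = 0 /\ vm_act n.+1%:Z d v = 0,
        vm_act 0 a v = - v,
        vm_act 0 d v = real_complex R (2 * nu) *: v
      & generated_by (fun x => x = v)].

Definition level (u : nat) : C := -3 + u%:R / 2.

(* The inverse-reduction embedding of A_2(u,2) in the tensor product [irX] of
   BP(u,2), the ghost algebra and the half-lattice algebra. *)
Record inverse_reduction (u : nat) := InverseReduction {
  irA : vertexAlgebra C;
  cur : 'M[C]_3 -> irA;
  irA_affine : is_simple_affine_sl3 (level u) cur;

  irB : vertexAlgebra C;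
  irJ : irB; irL : irB; irGp : irB; irGm : irB;
  irB_BP : is_simple_BP (level u) irJ irL irGp irGm;

  irG : vertexAlgebra C;
  irbe : irG; irga : irG;
  irG_ghosts : is_ghosts irbe irga;

  irP : vertexAlgebra C;
  ira : irP; ird : irP; irex : int -> irP;
  irP_half_lattice : is_half_lattice ira ird irex;

  irX : vertexAlgebra C;
  iB : irB -> irX; iG : irG -> irX; iP : irP -> irX;
  irX_tensor : is_va_tensor3 iB iG iP;

  emb : irA -> irX;
  emb_hom : is_va_hom emb;
  emb_inj : injective emb;
  emb_values :
    let k := level u in
    let i1 := iP ((2 * k / 3) *: ira + 2^-1 *: ird) in
    let i2' := - (k / 3) *: ira + 2^-1 *: ird in
    let i2 := iP i2' in
    let J := iB irJ in let be := iG irbe in let ga := iG irga in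
    let ep := iP (irex 1) in let em := iP (irex (-1)) in
    [/\ emb (cur (E3 0 1)) = ga ** ep /\ emb (cur (E3 1 2)) = be,
        emb (cur (E3 0 2)) = ep,
        emb (cur (E3 0 0 - E3 1 1)) = - J - be ** ga + i1 /\
        emb (cur (E3 1 1 - E3 2 2)) = 2 *: J + 2 *: (be ** ga) + i2,
        emb (cur (E3 1 0)) =
          iB irGp ** em - J ** (be ** em) + be ** iP (i2' ** irex (-1))
          + (k + 1) *: (der be ** em)
      & emb (cur (E3 2 1)) =
          iB irGm - 2 *: (J ** ga) - ga ** i2 - ga ** (ga ** be)
          - k *: der ga]
}.

Section RelaxedModules.
Variables (u : nat) (D : inverse_reduction u).
Local Notation A := (irA D).
Local Notation x := (@cur u D).

(* [M] is the module \hat R_{l,t}. *)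
Definition is_fully_relaxed (l : labels) (t : torus R) (M : vaModule A) :
    Prop :=
  exists (mu nu : R) (H : vaModule (irB D)) (W : vaModule (irG D))
    (N : vaModule (irP D)) (Y : vaModule (irX D)) (T : H -> W -> N -> Y),
    t = cls ((jwt R l + mu + u%:R / 6) *: alpha2 R
             + (nu - u%:R / 6) *: alpha3 R) /\
    [/\ is_hw_BP u l (irJ D) (irL D) (irGp D) (irGm D) H,
        is_relaxed_ghost mu (irbe D) (irga D) W,
        is_half_lattice_module nu (ira D) (ird D) N,
        is_tensor3 T /\
        (forall n b g p h w v,
           [/\ vm_act n (iB b) (T h w v) = T (vm_act n b h) w v,
               vm_act n (iG g) (T h w v) = T h (vm_act n g w) v
             & vm_act n (iP p) (T h w v) = T h w (vm_act n p v)])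
      & module_iso (restrict (emb_hom D) Y) M].

(* [M'] is \hat\sigma^g(M).  Let s be the automorphism of index g in the
   definition of the spectral flow; then [M'] has the same underlying space as
   [M], and y in \hat{sl}_3 acts on it as s^{-1}(y) does on [M]. *)
Definition is_spectral_flow (g : coweight) (M M' : vaModule A) : Prop :=
  exists f : M -> M',
    [/\ linear f, bijective f,
        forall (i j : 'I_3) (n : int) (m : M), i != j ->
          vm_act n (x (E3 i j)) (f m) =
          f (vm_act (n + (cow_diag g i - cow_diag g j)) (x (E3 i j)) m)
      & forall (h : 'rV[C]_3) (n : int) (m : M), \tr (diag_mx h) = 0 ->
          vm_act n (x (diag_mx h)) (f m) =
          f (vm_act n (x (diag_mx h)) m
             + (if n == 0 then
                  (level u * \sum_(i < 3) (cow_diag g i)%:~R * h 0 i) *: m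
                else 0))].

(* Multiplicities are counted for the simultaneous action of \mathfrak h and,
   in the generalised sense, of L_0. *)
Definition weight_space (M : vaModule A) (chi : 'rV[C]_3 -> C) (De : C)
    (m : M) : Prop :=
  (forall h, \tr (diag_mx h) = 0 ->
     vm_act 0 (x (diag_mx h)) m = chi h *: m) /\
  exists N : nat,
    iter N (fun m' => vm_act 1 (sugawara (level u) x) m' - De *: m') m = 0.

Definition fg_weight_module (M : vaModule A) : Prop :=
  [/\ exists s : seq M, generated_by (fun m => m \in s),
      forall m : M,
        in_span (fun m' => exists chi De, weight_space chi De m') m
    & forall chi De, fin_dim (@weight_space M chi De)].

(* [cl] sends modules to their images in (a completion of) the complexified
   Grothendieck group of the category [fg_weight_module]. *)
Record is_grothendieck (E : lmodType C) (cl : vaModule A -> E) : Prop :=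
  IsGrothendieck {
  gr_iso : forall M N, module_iso M N -> cl M = cl N;
  gr_exact : forall (M1 M2 M3 : vaModule A) (f : M1 -> M2) (f' : M2 -> M3),
    fg_weight_module M1 -> fg_weight_module M2 -> fg_weight_module M3 ->
    short_exact f f' -> cl M2 = cl M1 + cl M3
}.

Definition induced_by_fusion (E : lmodType C) (cl : vaModule A -> E)
    (box : E -> E -> E) : Prop :=
  [/\ forall b, linear (fun a => box a b), forall a, linear (box a)
    & forall M N F, fg_weight_module M -> fg_weight_module N ->
        is_fusion_product (sugawara (level u) x) fg_weight_module M N F ->
        box (cl M) (cl N) = cl F].

End RelaxedModules.
End InverseReduction.

(* Main.v *)
(* The denominator of [S_hw] is a trigonometric polynomial in the continuous
   parameter, with seven frequencies: 0 and the coweights +-g^i.  Hence only the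
   spectral flows by these seven coweights contribute to the Verlinde formula,
   and the delta functions fix the continuous parameter of the product.  The
   Fourier coefficients are powers of the phase by which the entries of the
   Bershadsky-Polyakov S-matrix are multiplied under [nabla], so that summing
   over the discrete labels gives fusion coefficients at a shifted label. *)
Require Import Defs.
From mathcomp Require Import all_boot all_order all_fingroup all_algebra.
From mathcomp Require Import complex ring_quotient zify ring lra.
From mathcomp Require Import all_classical all_reals all_analysis.

Import Order.TTheory GRing.Theory Num.Theory.
Local Open Scope ring_scope.

(** * The character x -> exp(2 pi i x) of R / Z *)

Section Phase.
Variable R : realType.
Implicit Types x y : R.

Lemma phaseD x y : phase (x + y) = phase x * phase y.
Proof.
rewrite /phase mulrDr cosD sinD.
by apply/eqP; rewrite eq_complex /=; apply/andP; split; apply/eqP; ring.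
Qed.

Lemma phase0 : phase (0 : R) = 1.
Proof. by rewrite /phase mulr0 cos0 sin0. Qed.

Lemma phaseN x : phase (- x) = (phase x)^*.
Proof. by rewrite /phase mulrN cosN sinN. Qed.

Lemma phaseNK x : phase x * phase (- x) = 1.
Proof. by rewrite -phaseD subrr phase0. Qed.

Lemma phase_neq0 x : phase x != 0.
Proof.
by apply/eqP => h; have /esym/eqP := phaseNK x; rewrite h mul0r oner_eq0.
Qed.

Lemma phase_int x : x \is a Num.int -> phase x = 1.
Proof.
have phase_nat (n : nat) : phase (n%:R : R) = 1.
  elim: n => [|n IHn]; first exact: phase0.
  by rewrite -natr1 phaseD IHn mul1r /phase mulr1 mulr_natl cos2pi sin2pi.
case/intrP => -[n|n] ->; first exact: phase_nat.
by rewrite NegzE mulrNz phaseN phase_nat rmorph1.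
Qed.

(** For the fractional part [t] of [x], cos(2 pi t) = 1 forces sin(pi t) = 0, while sin is positive
    strictly between 0 and pi; hence [t] = 0. *)
Lemma phase_eq1 x : phase x = 1 -> x \is a Num.int.
Proof.
move=> x1; set t := x - (Num.floor x)%:~R.
have t1 : phase t = 1.
  by rewrite phaseD x1 phase_int ?mul1r // rpredN intr_int.
have t_lt1 : t < 1 by rewrite ltrBlDl -intrD1 floorD1_gt.
have t_ge0 : 0 <= t by rewrite subr_ge0 floor_le.
rewrite intrEfloor eq_sym -subr_eq0 -/t.
apply/contraT; rewrite neq_lt ltNge t_ge0 /= => t_gt0.
have : 0 < sin (pi * t).
  by rewrite sin_gt0_pi // pmulr_rgt0 ?pi_gt0 // t_gt0 gtr_pMr ?pi_gt0.
case: t1 => + _; rewrite -mulrA mulr_natl cos_mulr2n => ct.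
have := cos2Dsin2 (pi * t); have -> : cos (pi * t) ^+ 2 = 1 by lra.
move/(canRL (addKr _)); rewrite addNr => /eqP; rewrite sqrf_eq0 => /eqP ->.
by rewrite ltxx.
Qed.

End Phase.

(** * The action of [nabla] on the Bershadsky-Polyakov S-matrix *)

Section SimpleCurrent.
Variables (R : realType) (u : nat).
Hypothesis u_ge3 : (3 <= u)%N.

Let i0 : 'I_3 := @Ordinal 3 0 isT.
Let i1 : 'I_3 := @Ordinal 3 1 isT.
Let i2 : 'I_3 := @Ordinal 3 2 isT.

Lemma big_I3 (V : nmodType) (F : 'I_3 -> V) :
  \sum_(i < 3) F i = F i0 + F i1 + F i2.
Proof.
rewrite !big_ord_recr big_ord0 /= add0r.
by congr (F _ + F _ + F _); apply: val_inj.
Qed.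

Lemma I3P (P : 'I_3 -> Prop) : P i0 -> P i1 -> P i2 -> forall i, P i.
Proof.
move=> P0 P1 P2 [[|[|[|//]]] p].
- by rewrite (_ : Ordinal p = i0) //; exact: val_inj.
- by rewrite (_ : Ordinal p = i1) //; exact: val_inj.
- by rewrite (_ : Ordinal p = i2) //; exact: val_inj.
Qed.

Definition rot3 : 'S_3 := (tperm i0 i1 * tperm i0 i2)%g.

Lemma odd_rot3 : odd_perm rot3 = false.
Proof. by rewrite odd_permM !odd_tperm. Qed.

Lemma rot3E : [/\ rot3 i0 = i1, rot3 i1 = i2 & rot3 i2 = i0].
Proof. by split; rewrite permM !permE. Qed.

Lemma eps_rho_shift (l : labels)
    (b1 := l.1.2%:R + 1 : R) (b2 := l.2%:R + 1 : R) :
  [/\ eps (rho_shift R l) 0 i0 = (2 * b1 + b2) / 3,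
      eps (rho_shift R l) 0 i1 = (b2 - b1) / 3
    & eps (rho_shift R l) 0 i2 = - (b1 + 2 * b2) / 3].
Proof.
by split; rewrite /eps /rho_shift /omega1 /omega2 /wt !mxE /=
  -[l.1.2.+1%:R]natr1 -[l.2.+1%:R]natr1 -/b1 -/b2;
  field.
Qed.

Lemma alcove_sum (n : alcove u) (l := to_labels n) :
  l.1.1%:R = u%:R - 3 - l.1.2%:R - l.2%:R :> R.
Proof.
rewrite -natrB // -(eqP (valP n)) !natrD /l /=; ring.
Qed.

(** The level condition eliminates lambda_0; what remains is a rotation followed by the translation
    by u omega_2, whose [eps] coordinates are u/3, u/3, -2u/3. *)
Lemma eps_rho_nabla (n : alcove u) i :
  eps (rho_shift R (to_labels (nabla n))) 0 i =
  eps (rho_shift R (to_labels n)) 0 (rot3 i) + u%:R * (3^-1 - (i == i2)%:R).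
Proof.
have [r0 r1 r2] := rot3E; have h := alcove_sum n.
have [e0 e1 e2] := eps_rho_shift (to_labels n).
have [f0 f1 f2] := eps_rho_shift (to_labels (nabla n)).
elim/I3P: i; rewrite ?r0 ?r1 ?r2 ?e0 ?e1 ?e2 ?f0 ?f1 ?f2 /=;
  rewrite ?[((val n).1.1 : nat)%:R]h /=; by field.
Qed.

(** The [eps] coordinates of an integral weight are congruent modulo 1, so the phase does not depend
    on [i]; this lets it factor out of the sum over the Weyl group. *)
Lemma phase_eps_rho (l : labels) i :
  phase (2 * eps (rho_shift R l) 0 i) = phase (- jwt R l).
Proof.
have [e0 e1 e2] := eps_rho_shift l.
have phaseDint (x y : R) : y \is a Num.int -> phase (x + y) = phase x.
  by move=> /phase_int y1; rewrite phaseD y1 mulr1.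
elim/I3P: i; rewrite ?e0 ?e1 ?e2 /jwt.
- rewrite -[RHS](phaseDint _ (l.1.2%:R + l.2%:R + 2)).
    by congr phase; field.
  by rewrite !rpredD ?rpred_nat ?rpred1.
- rewrite -[RHS](phaseDint _ (l.2%:R - l.1.2%:R)).
    by congr phase; field.
  by rewrite rpredB ?rpred_nat ?rpred1.
- rewrite -[RHS](phaseDint _ (- (l.1.2%:R + l.2%:R + 2))).
    by congr phase; field.
  by rewrite rpredN !rpredD ?rpred_nat ?rpred1.
Qed.

(* [nabla] acts on shifted weights as the affine map [eps_rho_nabla]: its linear
   part is an even element of the Weyl group, and its translation part
   contributes the same phase to all the terms of the sum over the Weyl group. *)
Lemma S_BP_nabla (n : alcove u) (L : labels) :
  S_BP R u (to_labels (nabla n)) L =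
  phase (- (jwt R L - u%:R / 3)) * S_BP R u (to_labels n) L.
Proof.
have u0 : u%:R != 0 :> R by rewrite pnatr_eq0 -lt0n (leq_trans _ u_ge3).
have weyl w : phase (- 2 * weyl_form w (rho_shift R (to_labels (nabla n)))
      (rho_shift R L) / u%:R) =
    phase (- 2 * weyl_form (w * rot3)%g (rho_shift R (to_labels n))
      (rho_shift R L) / u%:R) * phase (- jwt R L).
  (* The translation contributes -u times the coordinate of [L] at w^-1(i2), because the coordinates
     sum to 0; the prefactor -2/u turns this into twice that coordinate. *)
  rewrite -(phase_eps_rho L (w^-1%g i2)) -phaseD; congr phase.
  rewrite /weyl_form /dot3.
  under eq_bigr => i _ do rewrite mxE eps_rho_nabla -permM mulrDl.
  under [X in _ = -2 * X / _ + _]eq_bigr => i _ do rewrite mxE.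
  rewrite big_split /= mulrDr mulrDl; congr (_ + _).
  have sum0 : \sum_i eps (rho_shift R L) 0 i = 0.
    rewrite big_I3; have [-> -> ->] := eps_rho_shift L; by field.
  under eq_bigr => i _ do rewrite mulrBr mulrBl.
  rewrite sumrB -mulr_sumr sum0 mulr0 sub0r.
  rewrite (bigD1 (w^-1%g i2)) //= permKV eqxx big1 ?addr0 ?mulr1.
    by field.
  move=> i; rewrite -(can_eq (permK w)) permKV => /negPf ->.
  by rewrite mulr0 mul0r.
have sumE : \sum_(w : 'S_3) (-1) ^+ w *
      phase (- 2 * weyl_form w (rho_shift R (to_labels (nabla n)))
        (rho_shift R L) / u%:R) =
    (\sum_(w : 'S_3) (-1) ^+ w * phase (- 2 * weyl_form w
        (rho_shift R (to_labels n)) (rho_shift R L) / u%:R)) * phase (- jwt R L).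
  rewrite [in RHS](reindex_inj (mulIg rot3)) mulr_suml; apply: eq_bigr => w _.
  rewrite odd_permM odd_rot3 addbF -[RHS]mulrA; congr (_ * _); exact: weyl.
rewrite /S_BP sumE; set Sig := \sum_(_ | _) _.
suff e : phase (jwt R (to_labels (nabla n)) + jwt R L - u%:R / 3) =
    phase (u%:R / 3) * phase (jwt R (to_labels n) + jwt R L - u%:R / 3).
  by rewrite e opprB [phase (u%:R / 3 - _)]phaseD; ring.
rewrite -phaseD; set m := to_labels n; have h := alcove_sum n.
(* With lambda_0 eliminated, [jwt] at [nabla n] is [jwt] at [n] plus u/3 - 1 - lambda_2, and [phase]
   does not see the integer. *)
rewrite -[RHS]mulr1 -(@phase_int R (- (1 + m.2%:R))); last first.
  by rewrite rpredN rpredD ?rpred_nat ?rpred1.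
rewrite -phaseD; congr phase.
by rewrite /jwt /= [((val n).1.1 : nat)%:R]h /=; by field.
Qed.

End SimpleCurrent.

(** * Uniqueness of delta combinations on the torus *)

Section DeltaCombinations.
Variable R : realType.
Implicit Types (x y : hR R) (g G H : coweight) (s : seq (R[i] * hR R)).

Lemma pairE x g : pair x g = x 0 0 * (g 0 0)%:~R + x 0 1 * (g 0 1)%:~R.
Proof.
rewrite /pair !big_ord_recr big_ord0 /= add0r.
by congr (x _ _ * (g _ _)%:~R + x _ _ * (g _ _)%:~R); apply: val_inj.
Qed.

Lemma pairDl x y g : pair (x + y) g = pair x g + pair y g.
Proof. by rewrite -big_split /=; apply: eq_bigr => i _; rewrite mxE mulrDl. Qed.

Lemma pairDr x g H : pair x (g + H) = pair x g + pair x H.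
Proof.
by rewrite -big_split /=; apply: eq_bigr => i _; rewrite mxE intrD mulrDr.
Qed.

Lemma pairNl x g : pair (- x) g = - pair x g.
Proof. by rewrite /pair -sumrN; apply: eq_bigr => i _; rewrite mxE mulNr. Qed.

Lemma pairNr x g : pair x (- g) = - pair x g.
Proof.
by rewrite /pair -sumrN; apply: eq_bigr => i _; rewrite mxE mulrNz mulrN.
Qed.

Lemma pairZl (c : R) x g : pair (c *: x) g = c * pair x g.
Proof. by rewrite /pair mulr_sumr; apply: eq_bigr => i _; rewrite mxE mulrA. Qed.

Lemma pair0 x : pair x 0 = 0.
Proof. by rewrite /pair big1 // => i _; rewrite mxE mulr0. Qed.

Lemma pair_int x g : x \in @root_lattice R -> pair x g \is a Num.int.
Proof.
by move=> /forallP h; apply: rpred_sum => i _; rewrite rpredM ?h ?intr_int.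
Qed.

Lemma root_latticeP x :
  reflect (pair x g1 \is a Num.int /\ pair x g2 \is a Num.int)
    (x \in @root_lattice R).
Proof.
have p1 : pair x g1 = x 0 0 by rewrite pairE !mxE /= mulr1 mulr0 addr0.
have p2 : pair x g2 = x 0 1 by rewrite pairE !mxE /= mulr1 mulr0 add0r.
apply: (iffP forallP) => [h|[]]; first by rewrite p1 p2.
rewrite p1 p2 => h0 h1 -[[|[|//]] p].
  by rewrite (_ : Ordinal p = 0) //; apply: val_inj.
by rewrite (_ : Ordinal p = 1) //; apply: val_inj.
Qed.

Lemma eq_cls x y : (cls x == cls y) = (x - y \in @root_lattice R).
Proof. by rewrite Quotient.idealrBE. Qed.

Lemma phase_pair_cls x y g :
  cls x = cls y -> phase (pair (- x) g) = phase (pair (- y) g).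
Proof.
move/eqP; rewrite eq_cls => /pair_int h.
have -> : pair (- y) g = pair (- x) g + pair (x - y) g by rewrite -pairDl addKr.
by rewrite phaseD [phase (pair (x - y) g)]phase_int ?mulr1.
Qed.

(** Two candidates suffice because [g1] and [g2] generate the character group of the torus. *)
Definition separator x y : coweight :=
  if phase (pair (- x) g1) != phase (pair (- y) g1) then g1 else g2.

Lemma separatorP x y : cls x != cls y ->
  phase (pair (- x) (separator x y)) != phase (pair (- y) (separator x y)).
Proof.
rewrite /separator; case: ifP => // /negbFE/eqP e1; apply: contra => /eqP e2.
have phase_int_sub g : phase (pair (- x) g) = phase (pair (- y) g) ->
    pair (x - y) g \is a Num.int.
  move=> e; apply: phase_eq1.
  have -> : x - y = - y - - x by rewrite opprK addrC.
  rewrite pairDl phaseD -e -phaseD -pairDl subrr -[0](subrr 0) pairDl pairNl.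
  by rewrite subrr phase0.
by rewrite eq_cls; apply/root_latticeP; split; apply: phase_int_sub.
Qed.

(* Linear independence of characters: applying the operators
   [f |-> f (G + H) - chi H * f G] kills the characters [chi] other than the
   one of [p]. *)
Lemma delta_comb0_coef s p : is_delta_comb (fun _ _ => 0) s ->
  \sum_(d <- s | cls d.2 == cls p) d.1 = 0.
Proof.
move=> h0.
have h (hs : seq (coweight * R[i])) G :
    \sum_(d <- s) d.1 * phase (pair (- d.2) G) *
    \prod_(e <- hs) (phase (pair (- d.2) e.1) - e.2) = 0.
  elim: hs G => [|[H c] hs IHhs] G.
    rewrite [RHS](h0 G 0); apply: eq_bigr => d _.
    by rewrite big_nil mulr1 sub0r.
  transitivity (\sum_(d <- s) d.1 * phase (pair (- d.2) (G + H)) *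
      \prod_(e <- hs) (phase (pair (- d.2) e.1) - e.2) -
      c * \sum_(d <- s) d.1 * phase (pair (- d.2) G) *
      \prod_(e <- hs) (phase (pair (- d.2) e.1) - e.2)); last first.
    by rewrite !IHhs mulr0 subr0.
  rewrite mulr_sumr -sumrB; apply: eq_bigr => d _.
  by rewrite big_cons /= pairDr phaseD; ring.
(* One difference operator for each point of [s] outside the class of [p]: it kills the character of
   that point, and its factor at [p] is nonzero by [separatorP]. *)
pose hs := [seq (separator p d.2, phase (pair (- d.2) (separator p d.2)))
           | d <- s & cls d.2 != cls p].
pose w x := \prod_(e <- hs) (phase (pair (- x) e.1) - e.2).
have wp : w p != 0.
  rewrite /w big_map big_filter prodf_seq_neq0; apply/allP => d _.
  by apply/implyP => dp; rewrite subr_eq0 separatorP // eq_sym.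
apply/eqP; rewrite -(mulIr_eq0 _ (mulIf wp)); apply/eqP.
rewrite -[RHS](h hs 0) [RHS](bigID (fun d => cls d.2 == cls p)) /=.
rewrite [X in _ = _ + X]big_seq_cond [X in _ = _ + X]big1 ?addr0.
  rewrite mulr_suml; apply: eq_bigr => d /eqP dp.
  rewrite pair0 phase0 mulr1; congr (_ * _).
  by apply: eq_bigr => e _; rewrite (phase_pair_cls _ _ _ dp).
move=> d /andP[sd dp]; rewrite [X in _ * X](_ : _ = 0) ?mulr0 //.
apply/eqP; rewrite prodf_seq_eq0; apply/hasP.
exists (separator p d.2, phase (pair (- d.2) (separator p d.2))).
  by apply/mapP; exists d; rewrite // mem_filter dp.
by rewrite /= subrr.
Qed.

Lemma delta_int0 (E : lmodType R[i]) s (F : torus R -> E) :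
  is_delta_comb (fun _ _ => 0) s -> delta_int s F = 0.
Proof.
move=> s0; set r := undup [seq cls d.2 | d <- s].
transitivity (\sum_(t <- r) (\sum_(d <- s | cls d.2 == t) d.1) *: F t).
  under [RHS]eq_bigr => t _ do rewrite scaler_suml big_mkcond /=.
  rewrite exchange_big /= /delta_int !big_seq; apply: eq_bigr => d sd.
  rewrite [RHS](bigD1_seq (cls d.2)) /r ?undup_uniq ?mem_undup //=;
    last exact: map_f.
  by rewrite eqxx big1 ?addr0 // => t; rewrite eq_sym => /negPf ->.
apply: big1_seq => t; rewrite mem_undup => /mapP[d sd ->].
by rewrite delta_comb0_coef // scale0r.
Qed.

(** The Verlinde hypothesis supplies some combination with a given Fourier series; this allows an
    explicit one in its place. The difference of the two is a combination for the zero series. *)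
Lemma delta_int_unique (E : lmodType R[i]) (phi : coweight -> hR R -> R[i]) s s'
    (F : torus R -> E) :
  is_delta_comb phi s -> is_delta_comb phi s' -> delta_int s F = delta_int s' F.
Proof.
move=> hs hs'; apply/eqP; rewrite -subr_eq0; apply/eqP.
transitivity (delta_int (s ++ [seq (- d.1, d.2) | d <- s']) F).
  rewrite /delta_int big_cat /= big_map -sumrN; congr (_ + _).
  by apply: eq_bigr => d _; rewrite scaleNr.
apply: delta_int0 => G x; rewrite big_cat /= big_map /=.
under [X in _ = _ + X]eq_bigr => d _ do rewrite mulNr.
by rewrite sumrN -hs -hs' subrr.
Qed.

End DeltaCombinations.

(** * Integrals of trigonometric polynomials over the torus *)

Section TorusIntegral.
Variable R : realType.
Import numFieldNormedType.Exports.
Local Open Scope classical_set_scope.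

(** This family is closed under differentiation and, for nonzero [k], contains its own
    antiderivatives, so one formula yields both continuity and the antiderivative used below. *)
Lemma is_derive_cos_sin (p q k y x : R) :
  is_derive x 1 (fun a => p * cos (k * a + y) + q * sin (k * a + y))
    (k * q * cos (k * x + y) - k * p * sin (k * x + y)).
Proof.
have aff : is_derive x 1 (fun a => k * a + y) k.
  by apply: is_derive_eq; rewrite ?scaler0 ?addr0 ?add0r /GRing.scale /= ?mulr1.
have dc := @is_derive1_comp R cos (fun a => k * a + y) x _ _
  (is_derive_cos (k * x + y)) aff.
have ds := @is_derive1_comp R sin (fun a => k * a + y) x _ _
  (is_derive_sin (k * x + y)) aff.
have := is_deriveD (is_deriveZ p dc) (is_deriveZ q ds).
move/is_derive_eq; apply; rewrite /GRing.scale /=; ring.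
Qed.

Lemma continuous_cos_sin (p q k y : R) :
  continuous (fun a => p * cos (k * a + y) + q * sin (k * a + y)).
Proof.
move=> x; apply: differentiable_continuous; apply/derivable1_diffP.
by have [] := is_derive_cos_sin p q k y x.
Qed.

(** The antiderivative with coefficients -q/k and p/k takes equal values at 0 and 1. *)
Lemma unit_int_cos_sin (p q k y : R) : k != 0 ->
  cos (k + y) = cos y -> sin (k + y) = sin y ->
  unit_int (fun a => p * cos (k * a + y) + q * sin (k * a + y)) = 0.
Proof.
move=> k0 cosk sink; rewrite /unit_int /Rintegral.
pose F a : R := - q / k * cos (k * a + y) + p / k * sin (k * a + y).
rewrite (@continuous_FTC2 _ _ F) ?ltr01 //.
- by rewrite /F mulr1 mulr0 add0r cosk sink -EFinB subrr.
- exact/continuous_subspaceT/continuous_cos_sin.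
- split=> [x _||].
  + by have [] := is_derive_cos_sin (- q / k) (p / k) k y x.
  + exact/cvg_at_right_filter/continuous_cos_sin.
  + exact/cvg_at_left_filter/continuous_cos_sin.
- move=> x _; rewrite derive1E.
  have [_ ->] := is_derive_cos_sin (- q / k) (p / k) k y x.
  by field.
Qed.

Lemma Re_phase (c : R[i]) (x : R) :
  complex.Re (c * phase x) =
  complex.Re c * cos (2 * pi * x) + - complex.Im c * sin (2 * pi * x).
Proof. by case: c => a b /=; rewrite mulNr. Qed.

Lemma continuous_Re_phase (c : R[i]) (m : int) (y : R) :
  continuous (fun a : R => complex.Re (c * phase (m%:~R * a + y))).
Proof.
rewrite (_ : (fun _ => _) = fun a => complex.Re c *
    cos (2 * pi * m%:~R * a + 2 * pi * y) +
    - complex.Im c * sin (2 * pi * m%:~R * a + 2 * pi * y)).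
  exact: continuous_cos_sin.
by apply/funext => a; rewrite Re_phase mulrDr !mulrA.
Qed.

Lemma unit_int_phase (c : R[i]) (m : int) (y : R) :
  unit_int (fun a : R => complex.Re (c * phase (m%:~R * a + y))) =
  complex.Re (c * (m == 0)%:R * phase y).
Proof.
have phase_period : phase (m%:~R + y) = phase y.
  by rewrite phaseD phase_int ?mul1r ?intr_int.
have [->|m0] := eqVneq m 0.
  rewrite mulr1 /unit_int; under eq_Rintegral => a _ do rewrite mul0r add0r.
  rewrite Rintegral_cst //= lebesgue_measure_itv /= lte_fin ltr01.
  by rewrite oppr0 adde0 mulr1.
rewrite mulr0 mul0r /= -[RHS](@unit_int_cos_sin (complex.Re c) (- complex.Im c)
  (2 * pi * m%:~R) (2 * pi * y)).
- rewrite /unit_int; apply: eq_Rintegral => a _.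
  by rewrite Re_phase mulrDr !mulrA.
- by rewrite !mulf_neq0 ?intr_eq0 ?pnatr_eq0 // gt_eqF ?pi_gt0.
- by move: phase_period; rewrite /phase mulrDr => -[].
- by move: phase_period; rewrite /phase mulrDr => -[].
Qed.

Lemma continuous_big_sum (I : Type) (s : seq I) (f : I -> R -> R) :
  (forall i, continuous (f i)) -> continuous (fun x => \sum_(i <- s) f i x).
Proof.
move=> fc; elim: s => [|i s IHs].
  under eq_fun do rewrite big_nil; move=> x; exact: cvg_cst.
under eq_fun do rewrite big_cons.
by move=> x; apply: cvgD; [exact: fc|exact: IHs].
Qed.

Lemma unit_int_sum (I : Type) (s : seq I) (f : I -> R -> R) :
  (forall i, continuous (f i)) ->
  unit_int (fun x => \sum_(i <- s) f i x) = \sum_(i <- s) unit_int (f i).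
Proof.
move=> fc.
have int01 (g : R -> R) : continuous g ->
    (@lebesgue_measure R).-integrable `[0, 1]%classic (EFin \o g).
  move=> gc; apply: continuous_compact_integrable; first exact: segment_compact.
  exact: continuous_subspaceT.
elim: s => [|i s IHs].
  rewrite big_nil /unit_int; under eq_Rintegral do rewrite big_nil.
  by rewrite Rintegral_cst // mul0r.
rewrite big_cons -IHs /unit_int; under eq_Rintegral do rewrite big_cons.
rewrite RintegralD //; first exact/int01/fc.
exact/int01/continuous_big_sum.
Qed.

(** The order of the summands matches the shape m b + y of [unit_int_phase] for the inner variable
    [b]. *)
Lemma pair_wt (a b : R) (g : coweight) :
  pair (wt a b) g = (g 0 1)%:~R * b + (g 0 0)%:~R * a.
Proof.
by rewrite pairE !mxE /= addrC ![_ * _%:~R]mulrC.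
Qed.

Lemma coweight_eq0 (g : coweight) : (g == 0) = (g 0 0 == 0) && (g 0 1 == 0).
Proof.
apply/eqP/andP => [->|[/eqP g0 /eqP g1]]; first by rewrite !mxE.
apply/matrixP => i j; rewrite mxE ord1; case: j => -[|[|//]] p.
  by rewrite (_ : Ordinal p = 0) //; apply: val_inj.
by rewrite (_ : Ordinal p = 1) //; apply: val_inj.
Qed.

(** The inner integral kills the frequencies with nonzero second coordinate, the outer one those
    with nonzero first coordinate. *)
Lemma torus_int_Re (s : seq (R[i] * coweight)) :
  unit_int (fun a : R => unit_int (fun b =>
    complex.Re (\sum_(t <- s) t.1 * phase (pair (wt a b) t.2)))) =
  complex.Re (\sum_(t <- s) t.1 * (t.2 == 0)%:R).
Proof.
have ReD : {morph (@complex.Re R) : x y / x + y} by case=> ? ? [].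
transitivity (unit_int (fun a : R => \sum_(t <- s)
    complex.Re (t.1 * (t.2 0 1 == 0)%:R * phase ((t.2 0 0)%:~R * a + 0)))).
  apply: eq_Rintegral => a _.
  under [X in unit_int X]eq_fun => b.
    rewrite (big_morph _ ReD (erefl : complex.Re 0 = 0)).
    under eq_bigr do rewrite pair_wt.
    over.
  rewrite unit_int_sum; last by move=> t; exact: continuous_Re_phase.
  by apply: eq_bigr => t _; rewrite unit_int_phase addr0.
rewrite unit_int_sum; last by move=> t; exact: continuous_Re_phase.
rewrite (big_morph _ ReD (erefl : complex.Re 0 = 0)); apply: eq_bigr => t _.
rewrite unit_int_phase phase0 mulr1 coweight_eq0 andbC.
by case: (t.2 0 1 == 0); rewrite ?mulr0 ?mul0r ?mulr1.
Qed.

Lemma torus_int_trig (s : seq (R[i] * coweight)) :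
  torus_int (fun X => \sum_(t <- s) t.1 * phase (pair X t.2)) =
  \sum_(t <- s) t.1 * (t.2 == 0)%:R.
Proof.
(* Multiplying all coefficients by -i reduces the imaginary part to the real one. *)
have ImE (z : R[i]) : complex.Im z = complex.Re (Complex 0 (-1) * z).
  by case: z => a b /=; rewrite mul0r mulN1r opprK add0r.
rewrite /torus_int torus_int_Re; set z := \sum_(_ <- _) _.
suff -> : unit_int (fun a : R => unit_int (fun b =>
    complex.Im (\sum_(t <- s) t.1 * phase (pair (wt a b) t.2)))) = complex.Im z.
  by case: z.
pose s' := [seq (Complex 0 (-1) * t.1, t.2) | t <- s].
transitivity (unit_int (fun a : R => unit_int (fun b =>
    complex.Re (\sum_(t <- s') t.1 * phase (pair (wt a b) t.2))))).
  apply: eq_Rintegral => a _; apply: eq_Rintegral => b _.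
  rewrite ImE mulr_sumr big_map; congr complex.Re.
  by apply: eq_bigr => t _; rewrite mulrA.
rewrite torus_int_Re ImE mulr_sumr big_map; congr complex.Re.
by apply: eq_bigr => t _; rewrite mulrA.
Qed.

End TorusIntegral.

(** * Module homomorphisms tested on strong generators *)

Section ModuleHomomorphisms.
Local Set Implicit Arguments.
Local Unset Strict Implicit.
Variables (K : fieldType) (V : vertexAlgebra K).
Implicit Types M N : vaModule V.

Lemma eventually_shift (P : int -> Prop) (q : int) :
  (exists N : nat, forall j : nat, (N <= j)%N -> P j%:Z) ->
  exists N : nat, forall j : nat, (N <= j)%N -> P (q + j%:Z).
Proof.
move=> [N hN]; exists (N + absz q)%N => j hj.
have -> : q + j%:Z = (absz (q + j%:Z))%:Z by lia.
by apply: hN; lia.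
Qed.

Lemma linear0f (K' : pzRingType) (A B : lmodType K') (f : A -> B) :
  linear f -> f 0 = 0.
Proof.
by move=> lf; have := lf (-1) 0 0; rewrite scaler0 addr0 scaleN1r addNr.
Qed.

Lemma linear_sumf (K' : pzRingType) (A B : lmodType K') (f : A -> B) (I : Type)
    (s : seq I) (F : I -> A) :
  linear f -> f (\sum_(i <- s) F i) = \sum_(i <- s) f (F i).
Proof.
move=> lf; have f0 := linear0f lf; apply: (big_morph f _ f0) => a b.
by have := lf 1 a b; rewrite !scale1r.
Qed.

Lemma binz0S j : binz K 0 j.+1 = 0.
Proof. by rewrite /binz big_ord_recl subrr !mul0r. Qed.

Lemma binzx0 p : binz K p 0 = 1.
Proof. by rewrite /binz big_ord0 fact0 divr1. Qed.

(* The Borcherds identity with [p = 0] expresses the modes of [a_(r) b] in terms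
   of the modes of [a] and [b]. *)
Lemma act_prod_eventually M (a b : V) (r q : int) (c : M) :
  exists N0 : nat, forall N : nat, (N0 <= N)%N ->
  vm_act q (va_prod r a b) c =
  \sum_(j < N) ((-1) ^+ j * binz K r j) *:
      (vm_act (r - j%:Z) a (vm_act (q + j%:Z) b c)
       - (-1) ^ r *: vm_act (q + r - j%:Z) b (vm_act j%:Z a c)).
Proof.
have [N1 h1] :=
  eventually_shift (P := fun k => va_prod k a b = 0) r (va_trunc a b).
have [N2 h2] :=
  eventually_shift (P := fun k => vm_act k b c = 0) q (vm_trunc b c).
have [N3 h3] := vm_trunc a c.
(* The successor ensures that the left-hand sum has its term of index 0, the only one that survives
   when [p] = 0. *)
exists (N1 + N2 + N3).+1 => -[//|N] hN.
have := @vm_borcherds _ _ M a b c 0 q r N.+1.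
rewrite big_ord_recl /= binzx0 scale1r add0r subr0 addr0.
rewrite [X in _ + X = _]big1 => [|i _]; last by rewrite binz0S scale0r.
rewrite addr0 => E; rewrite E => [|j hj].
  by apply: eq_bigr => j _; rewrite !add0r.
by split; [apply: h1|apply: h2|rewrite add0r; apply: h3]; lia.
Qed.

(** The vectors all of whose modes commute with [f] satisfy the closure conditions of strong
    generation, since the modes of a product act as finite sums of composites of modes of its
    factors. *)
Lemma module_hom_of_generators (S : V -> Prop) M N (f : M -> N) :
  strongly_generated S -> linear f ->
  (forall n x m, S x -> f (vm_act n x m) = vm_act n x (f m)) ->
  is_module_hom f.
Proof.
move=> genV lf hS; split=> // n a m; move: a n m.
have f0 := linear0f lf.
apply: genV; first split.
- move=> n m; rewrite (linear0f (vm_linearl n m)) f0.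
  by rewrite (linear0f (vm_linearl n (f m))).
- move=> c x y hx hy n m.
  by rewrite !vm_linearl lf hx hy.
- by move=> n m; rewrite !vm_vac; case: ifP.
- move=> x r v Sx hv q m.
  have [N1 h1] := act_prod_eventually x v (- r.+1%:Z) q m.
  have [N2 h2] := act_prod_eventually x v (- r.+1%:Z) q (f m).
  (* The cut-offs at [m] and [f m] may differ; a common bound makes the two sums comparable term by
     term. *)
  rewrite (h1 (N1 + N2)%N) ?leq_addr // (h2 (N1 + N2)%N) ?leq_addl //.
  rewrite linear_sumf //; apply: eq_bigr => j _.
  have fZ c y : f (c *: y) = c *: f y.
    by have := lf c y 0; rewrite !addr0 f0 addr0.
  have fB y z : f (y - z) = f y - f z.
    by have := lf (-1) z y; rewrite !scaleN1r ![- _ + _]addrC.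
  by rewrite fZ fB fZ (hS _ x) // !hv (hS _ x).
Qed.

End ModuleHomomorphisms.

(** * Spectral flow by the zero coweight *)

Section TrivialSpectralFlow.
Variables (R : realType) (u : nat) (D : inverse_reduction R u).

Lemma mx_diag_offdiag (K : pzRingType) n (a : 'M[K]_n) :
  a = diag_mx (\row_i a i i) +
      \sum_i \sum_(j | j != i) a i j *: delta_mx i j.
Proof.
rewrite diag_mx_sum_delta -big_split /= [LHS]matrix_sum_delta.
by apply: eq_bigr => i _; rewrite (bigD1 i) //= mxE.
Qed.

(** This matches the unflowed modules of the theorem with the Verlinde formula, where every standard
    module is a flow. Off-diagonal matrix units and traceless diagonal matrices span the strong
    generators. *)
Lemma spectral_flow0_iso (M M' : vaModule (irA D)) :
  is_spectral_flow 0 M M' -> module_iso M M'.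
Proof.
case=> f [lf bf hE hd]; exists f; split=> //.
have cow0 i : cow_diag 0 i = 0 by rewrite /cow_diag big1 // => l _; rewrite mxE.
have aff := irA_affine D.
apply: (module_hom_of_generators (aff_gen aff) lf) => n y m [a tra ->].
(* Linearity of [cur] is available on traceless matrices only, so the trace condition is carried
   along. *)
pose W (b : 'M[R[i]]_3) := \tr b = 0 /\ forall n m,
  f (vm_act n (cur D b) m) = vm_act n (cur D b) (f m).
suff [] : W a by [].
have W0 : W 0.
  split=> [|k z]; first exact: mxtrace0.
  have -> : cur D 0 = 0.
    have := @aff_linear _ _ _ _ aff (-1) 0 0 (mxtrace0 _ _) (mxtrace0 _ _).
    by rewrite scaler0 addr0 scaleN1r addNr.
  rewrite (linear0f (vm_linearl k z)) (linear0f lf).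
  by rewrite (linear0f (vm_linearl k (f z))).
have WZD c b b' : W b -> W b' -> W (c *: b + b').
  move=> [trb hb] [trb' hb']; split=> [|k z].
    by rewrite linearD linearZ /= trb trb' mulr0 addr0.
  by rewrite (aff_linear aff) // !vm_linearl lf hb hb'.
have WD b b' : W b -> W b' -> W (b + b').
  by move=> hb hb'; rewrite -[b]scale1r; apply: WZD.
rewrite [a]mx_diag_offdiag; apply: (WD).
  have trd : \tr (diag_mx (\row_i a i i)) = 0.
    by rewrite mxtrace_diag -[RHS]tra; apply: eq_bigr => i _; rewrite mxE.
  split=> // k z; rewrite hd //; congr f.
  case: ifP => _; rewrite ?addr0 // big1 ?mulr0 ?scale0r ?addr0 // => i _.
  by rewrite cow0 mul0r.
apply: (big_ind W) => // i _; apply: (big_ind W) => // j ji.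
rewrite -[_ *: _]addr0; apply: WZD => //; split=> [|k z].
  rewrite /mxtrace big1 // => k _; rewrite mxE.
  by case: eqVneq => // ->; rewrite eq_sym (negPf ji).
by rewrite -/(E3 R i j) hE 1?eq_sym // !cow0 subrr addr0.
Qed.

End TrivialSpectralFlow.

(** * The Verlinde coefficients of the relaxed modules *)

Section FusionCoefficients.
Variables (R : realType) (u : nat).
Hypothesis u_ge3 : (3 <= u)%N.

(** By [S_BP_nabla], applying [nabla] to the first label of the S-matrix multiplies its entry at [L]
    by phase(- theta L). *)
Definition theta (L : labels) : R := jwt R L - u%:R / 3.

Definition N_BP_term (l m n L : labels) : R[i] :=
  S_BP R u l L * S_BP R u m L * (S_BP R u n L)^* / S_BP R u (vac_labels u) L.

(** Three times [theta L] is an integer, in accordance with [nabla] having order three. *)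
Lemma phase_theta3 (L : labels) :
  phase (theta L + theta L) = phase (- theta L).
Proof.
rewrite -[RHS]mulr1 -(@phase_int R (theta L + theta L + theta L)).
  by rewrite -phaseD; congr phase; ring.
have -> : theta L + theta L + theta L = L.2%:R - L.1.2%:R - u%:R.
  by rewrite /theta /jwt; field.
by rewrite !rpredB ?rpred_nat.
Qed.

(** The label [n] enters through a complex conjugate, which inverts the phase of [S_BP_nabla]. *)
Lemma N_BP_nabla (l m : labels) (n : alcove u) :
  N_BP R u l m (to_labels (nabla n)) =
  \sum_(L : alcove u)
    N_BP_term l m (to_labels n) (to_labels L) * phase (theta (to_labels L)).
Proof.
apply: eq_bigr => L _; rewrite S_BP_nabla //.
rewrite [(phase _ * _)^*]rmorphM /= -phaseN opprK /N_BP_term.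
by rewrite -/(theta _); ring.
Qed.

Lemma N_BP_nablaV (l m : labels) (n : alcove u) :
  N_BP R u l m (to_labels (nablaV n)) =
  \sum_(L : alcove u) N_BP_term l m (to_labels n) (to_labels L) *
    phase (theta (to_labels L) + theta (to_labels L)).
Proof.
apply: eq_bigr => L _; rewrite phase_theta3 -{2}[n]nablaVK /N_BP_term.
rewrite S_BP_nabla // [(phase _ * _)^*]rmorphM /= -phaseN opprK -/(theta _).
have := phaseNK _ (theta (to_labels L)).
set p := phase (theta _); set q := phase (- _) => pq.
by rewrite -[LHS]mulr1 -pq; ring.
Qed.

(* Coefficients and frequencies of [phase th] times the denominator of [S_hw],
   which is a trigonometric polynomial in the weight. *)
Definition hw_terms (th : R) : seq (R[i] * coweight) :=
  [:: (2 * phase th, 0); (1, g1); (phase (th + th), g2); (phase (th + th), g3);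
      (phase (th + th), - g1); (1, - g2); (1, - g3)].

Definition flows : seq coweight := [:: 0; - g1; - g2; - g3; g1; g2; g3].

Lemma flowsE th : [seq - t.2 | t <- hw_terms th] = flows.
Proof. by rewrite /= oppr0 !opprK. Qed.

Lemma two_cos (x : R) :
  real_complex R (2 * cos (2 * pi * x)) = phase x + phase (- x).
Proof.
rewrite /phase mulrN cosN sinN; apply/eqP.
by rewrite eq_complex /= subrr eqxx andbT mulr2n mulrDl mul1r.
Qed.

Lemma hw_termsE (L : labels) (X : hR R) (t := theta L) :
  phase t * real_complex R (2 *
    (1 + cos (2 * pi * (pair X g1 - jwt R L + u%:R / 3))
       + cos (2 * pi * (pair X g2 + jwt R L - u%:R / 3))
       + cos (2 * pi * (pair X g3 + jwt R L - u%:R / 3)))) =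
  \sum_(e <- hw_terms t) e.1 * phase (pair X e.2).
Proof.
have -> : pair X g1 - jwt R L + u%:R / 3 = pair X g1 - t.
  by rewrite /t /theta opprB addrAC addrA.
rewrite -2!(addrA (pair X _) (jwt R L)) -/(theta L) -/t.
clearbody t.
have realD : {morph real_complex R : a b / a + b}.
  by move=> a b; apply/eqP; rewrite eq_complex /= addr0 !eqxx.
rewrite 3!mulrDr mulr1 3!realD !two_cos.
rewrite (_ : real_complex R 2 = 2); last by rewrite realD.
rewrite !big_cons big_nil /= pair0 phase0 !pairNr !opprD !opprK !phaseD.
by have := phaseNK _ t; move: (phase t) (phase (- t)) => p q pq; ring: pq.
Qed.

Lemma hw_inverse (G : coweight) (L : labels) (X : hR R) :
  (S_hw u G L X)^-1 =
  (S_BP R u (vac_labels u) L)^-1 *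
  \sum_(e <- hw_terms (theta L)) e.1 * phase (pair X e.2).
Proof.
have phaseV x : (phase (- x))^-1 = phase x :> R[i].
  by apply: (mulIf (phase_neq0 _ (- x))); rewrite mulVf ?phase_neq0 // phaseNK.
(* As 0^-1 = 0, inverting the quotient is valid also where the sum of cosines vanishes. *)
rewrite -hw_termsE /S_hw invf_div mulrC invfM phaseV -/(theta L).
by rewrite [phase _ * _^-1]mulrC mulrA.
Qed.

(** By [torus_int_trig], this is the integral over the torus of phase(<X, g>) times the polynomial
    encoded by [hw_terms th]. *)
Definition flow_weight (th : R) (g : coweight) : R[i] :=
  \sum_(e <- hw_terms th) e.1 * (g + e.2 == 0)%:R.

Lemma flow_weight_out th g : g \notin flows -> flow_weight th g = 0.
Proof.
rewrite -(flowsE th) => gN; apply: big1_seq => e /andP[_ eT].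
have [ge0|] := eqVneq; last by rewrite mulr0.
by case/negP: gN; rewrite -[g]opprK (addr0_eq ge0) (map_f (fun t => - t.2)).
Qed.

Lemma flow_weightE th :
  [/\ flow_weight th 0 = 2 * phase th,
      [/\ flow_weight th (- g1) = 1, flow_weight th (- g2) = phase (th + th)
        & flow_weight th (- g3) = phase (th + th)]
    & [/\ flow_weight th g1 = phase (th + th), flow_weight th g2 = 1
        & flow_weight th g3 = 1]].
Proof.
by split; last split; try split;
  rewrite /flow_weight !big_cons big_nil !coweight_eq0 !mxE /=;
  rewrite ?mulr0 ?mulr1 ?add0r ?addr0.
Qed.

Lemma flows_uniq : uniq flows.
Proof.
have eqE (g h : coweight) : (g == h) = (g 0 0 == h 0 0) && (g 0 1 == h 0 1).
  by rewrite -subr_eq0 coweight_eq0 !mxE !subr_eq0.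
by rewrite /flows !cons_uniq !inE !eqE !mxE.
Qed.

Definition fusion_coef (l m n : labels) (g : coweight) : R[i] :=
  \sum_(L : alcove u)
    N_BP_term l m n (to_labels L) * flow_weight (theta (to_labels L)) g.

Lemma fusion_coef_out l m n g : g \notin flows -> fusion_coef l m n g = 0.
Proof.
by move=> gN; apply: big1 => L _; rewrite flow_weight_out ?mulr0.
Qed.

(** Inserting 1, phase(theta) or phase(2 theta) into the sum over [L] yields the fusion coefficient
    at [n], [nabla n] or [nablaV n] respectively. *)
Lemma fusion_coefE l m (n : alcove u) (c := fusion_coef l m (to_labels n)) :
  [/\ c 0 = 2 * N_BP R u l m (to_labels (nabla n)),
      [/\ c (- g1) = N_BP R u l m (to_labels n),
          c (- g2) = N_BP R u l m (to_labels (nablaV n))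
        & c (- g3) = N_BP R u l m (to_labels (nablaV n))]
    & [/\ c g1 = N_BP R u l m (to_labels (nablaV n)),
          c g2 = N_BP R u l m (to_labels n)
        & c g3 = N_BP R u l m (to_labels n)]].
Proof.
rewrite N_BP_nabla N_BP_nablaV /c /fusion_coef.
split; last split; try split; rewrite ?mulr_sumr; apply: eq_bigr => L _;
  have [w0 [w1 w2 w3] [v1 v2 v3]] := flow_weightE (theta (to_labels L));
  by rewrite ?w0 ?w1 ?w2 ?w3 ?v1 ?v2 ?v3 ?mulr1 // mulrCA.
Qed.

Lemma cow_formE (g G : coweight) : cow_form R g G = pair (cow_wt R g) G.
Proof.
rewrite /cow_form /Defs.form /dot3 big_I3 pairE /cow_wt /omega1 /omega2 /wt /eps.
by rewrite !mxE /=; field.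
Qed.

(** The integrand is a trigonometric polynomial in X, of which the integral keeps the constant term.
    [G] enters through a single character, hence a single delta function; its shift by (u/2) g comes
    from the term <g, G> u/2 of [S_hat]. *)
Lemma verlinde_term_delta (l l' n : labels) (x x' x'' : hR R) (g G : coweight) :
  verlinde_term u 0 l x 0 l' x' g n x'' G =
  fusion_coef l l' n g *
    phase (pair (x'' - (x + x' - (u%:R / 2) *: cow_wt R g)) G).
Proof.
rewrite /verlinde_term /fusion_coef mulr_suml; apply: eq_bigr => L _.
set P := phase (pair (_ - _) G); set K := N_BP_term _ _ _ _.
pose s := [seq (K * P * e.1, g + e.2) | e <- hw_terms (theta (to_labels L))].
transitivity (torus_int (fun X => \sum_(t <- s) t.1 * phase (pair X t.2))).
  congr torus_int; apply/funext => X.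
  rewrite hw_inverse big_map.
  under [RHS]eq_bigr => e _ do rewrite /= pairDr phaseD mulrACA.
  rewrite -mulr_sumr mulrA; congr (_ * _).
  rewrite /S_hat [(phase _ * _)^*]rmorphM /= -phaseN opprK !cow_formE.
  rewrite /K /N_BP_term.
  set a := phase _; set b := phase (- _); set c := phase (_ + _ + _).
  (* Both factors have zero flow, so X enters only through the conjugated entry. *)
  have abc : a * b * c = P * phase (pair X g).
    rewrite /a /b /c /P -!phaseD; congr phase.
    have w0 : pair (cow_wt R 0) G = 0.
      by rewrite pairE !mxE !mul0r !addr0 !mul0r addr0.
    rewrite w0 pair0 (pairDl _ x'') pairNl (pairDl _ (x + x')) (pairDl _ x).
    by rewrite pairNl pairZl; field.
  by ring: abc.
rewrite torus_int_trig big_map /= mulr_sumr mulr_suml; apply: eq_bigr => e _ /=.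
by ring.
Qed.

End FusionCoefficients.

(** * Assembly of the fusion rules *)

Lemma eq_big_seq_supp (I : eqType) (V : nmodType) (r s : seq I) (F : I -> V) :
  uniq r -> uniq s -> (forall i, i \notin r -> F i = 0) ->
  (forall i, i \notin s -> F i = 0) -> \sum_(i <- r) F i = \sum_(i <- s) F i.
Proof.
have sub (r' s' : seq I) : (forall i, i \notin s' -> F i = 0) ->
    \sum_(i <- r') F i = \sum_(i <- r' | i \in s') F i.
  by move=> s0; rewrite (bigID (mem s')) /= [X in _ + X]big1 ?addr0.
move=> Ur Us r0 s0; rewrite (sub r s s0) (sub s r r0).
rewrite -[LHS]big_filter -[RHS]big_filter.
apply: perm_big; apply: uniq_perm; rewrite ?filter_uniq // => i.
by rewrite !mem_filter andbC.
Qed.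

Theorem theorem5p15 (R : realType) (u : nat) (hu : (3 <= u)%N) (odd_u : odd u)
    (D : inverse_reduction R u)
    (Rhat : alcove u -> torus R -> vaModule (irA D))
    (sigma : coweight -> vaModule (irA D) -> vaModule (irA D))
    (hRhat : forall l t, is_fully_relaxed (to_labels l) t (Rhat l t))
    (hsigma : forall g M, is_spectral_flow g M (sigma g M))
    (E : lmodType R[i]) (cl : vaModule (irA D) -> E) (box : E -> E -> E)
    (hcl : is_grothendieck cl) (hbox : induced_by_fusion cl box)
    (hV : standard_verlinde box (fun g l t => cl (sigma g (Rhat l t))))
    (l l' : alcove u) (x x' : hR R) :
  box (cl (Rhat l (cls x))) (cl (Rhat l' (cls x'))) =
  \sum_(l'' : alcove u) N_BP R u (to_labels l) (to_labels l') (to_labels l'') *: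
    (2 *: cl (Rhat (nablaV l'') (cls (x + x')))
     + cl (sigma (- g1) (Rhat l'' (cls (x + x' + (u%:R / 2) *: omega1 R))))
     + cl (sigma (- g2) (Rhat (nabla l'') (cls (x + x' + (u%:R / 2) *: omega2 R))))
     + cl (sigma (- g3) (Rhat (nabla l'') (cls (x + x' + (u%:R / 2) *: omega3 R))))
     + cl (sigma g1 (Rhat (nabla l'') (cls (x + x' - (u%:R / 2) *: omega1 R))))
     + cl (sigma g2 (Rhat l'' (cls (x + x' - (u%:R / 2) *: omega2 R))))
     + cl (sigma g3 (Rhat l'' (cls (x + x' - (u%:R / 2) *: omega3 R))))).
Proof.
have sigma0 n t : cl (Rhat n t) = cl (sigma 0 (Rhat n t)).
  by apply: (gr_iso hcl); apply: spectral_flow0_iso.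
rewrite (sigma0 l) (sigma0 l').
have [I [delta [uI deltaP deltaN ->]]] := hV 0 0 l l' x x'.
under [RHS]eq_bigr => n _ do rewrite sigma0.
pose F (g : coweight) (n : alcove u) := cl (sigma g (Rhat n
  (cls (x + x' - (u%:R / 2) *: cow_wt R g)))).
pose c (g : coweight) (n : alcove u) :=
  fusion_coef R u (to_labels l) (to_labels l') (to_labels n) g.
(* The combination given by the hypothesis is replaced by the one-point combination of
   [verlinde_term_delta]. *)
have deltaE g n : delta_int (delta g n) (fun t => cl (sigma g (Rhat n t))) =
    c g n *: F g n.
  pose s := [:: (c g n, x + x' - (u%:R / 2) *: cow_wt R g)].
  rewrite (delta_int_unique _ _ _ _ s _ (deltaP g n));
    first by rewrite /delta_int big_seq1.
  by move=> G x''; rewrite big_seq1 verlinde_term_delta.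
transitivity (\sum_(g <- I) \sum_(n : alcove u) c g n *: F g n).
  by apply: eq_bigr => g _; apply: eq_bigr => n _; exact: deltaE.
(* [I] is only known to contain every flow with a nonzero combination; the summand vanishes outside
   [I] as well as outside [flows]. *)
rewrite (@eq_big_seq_supp _ _ I flows _ uI flows_uniq); first last.
- move=> g gN; apply: big1 => n _.
  by rewrite /c fusion_coef_out // scale0r.
- move=> g gN; apply: big1 => n _.
  by rewrite -deltaE deltaN // /delta_int big_nil.
rewrite /flows !big_cons big_nil addr0.
under [RHS]eq_bigr => n _ do rewrite 6!scalerDr.
rewrite !big_split /= !addrA.
(* Reindexing moves the rotation of the label from the fusion coefficient to the module. *)
have reV (H : alcove u -> E) :
    \sum_(n : alcove u) H n = \sum_(n : alcove u) H (nabla n).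
  by apply: reindex_inj; apply: can_inj (@nablaK u).
have re (H : alcove u -> E) :
    \sum_(n : alcove u) H n = \sum_(n : alcove u) H (nablaV n).
  by apply: reindex_inj; apply: can_inj (@nablaVK u).
have cw1 : cow_wt R g1 = omega1 R.
  by rewrite /cow_wt !mxE /= scale1r scale0r addr0.
have cw2 : cow_wt R g2 = omega2 R.
  by rewrite /cow_wt !mxE /= scale1r scale0r add0r.
have cw3 : cow_wt R g3 = omega3 R.
  by rewrite /cow_wt !mxE /= scale1r scaleN1r.
have cw0 : cow_wt R 0 = 0.
  by rewrite /cow_wt !mxE /= !scale0r addr0.
have cwN g : cow_wt R (- g) = - cow_wt R g.
  by rewrite /cow_wt !mxE !intrN !scaleNr opprD.
congr (_ + _ + _ + _ + _ + _ + _).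
- rewrite re; apply: eq_bigr => n _; have [c0 _ _] := fusion_coefE R u hu
    (to_labels l) (to_labels l') (nablaV n).
  by rewrite /c c0 nablaVK /F cw0 scaler0 subr0 mulrC scalerA.
- apply: eq_bigr => n _; have [_ [c1 _ _] _] := fusion_coefE R u hu
    (to_labels l) (to_labels l') n.
  by rewrite /c c1 /F cwN cw1 scalerN opprK.
- rewrite reV; apply: eq_bigr => n _; have [_ [_ c2 _] _] := fusion_coefE R u hu
    (to_labels l) (to_labels l') (nabla n).
  by rewrite /c c2 nablaK /F cwN cw2 scalerN opprK.
- rewrite reV; apply: eq_bigr => n _; have [_ [_ _ c3] _] := fusion_coefE R u hu
    (to_labels l) (to_labels l') (nabla n).
  by rewrite /c c3 nablaK /F cwN cw3 scalerN opprK.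
- rewrite reV; apply: eq_bigr => n _; have [_ _ [c1 _ _]] := fusion_coefE R u hu
    (to_labels l) (to_labels l') (nabla n).
  by rewrite /c c1 nablaK /F cw1.
- apply: eq_bigr => n _; have [_ _ [_ c2 _]] := fusion_coefE R u hu
    (to_labels l) (to_labels l') n.
  by rewrite /c c2 /F cw2.
- apply: eq_bigr => n _; have [_ _ [_ _ c3]] := fusion_coefE R u hu
    (to_labels l) (to_labels l') n.
  by rewrite /c c3 /F cw3.
Qed.
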